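(* Let $G=[g_1,g_2,\ldots]$ be a transcendental semigroup and let $U\subset F(G)$ be an invariant component. If there exists a constant limit function $\zeta$ of $G$ on $U$, then either $\zeta$ is a fixed point of $G$ or $\zeta=\infty$.
   Context: A transcendental semigroup $G=[g_1,g_2,\ldots]$ is the semigroup generated under composition by a family $\{g_1,g_2,\ldots\}$ of transcendental entire functions. The Fatou set $F(G)$ is the largest open subset of $\mathbb{C}$ on which the family $G$ is normal (every sequence in $G$ has a subsequence converging locally uniformly to a holomorphic function or to $\infty$). A connected component $U$ of $F(G)$ is invariant if $g(U)\subset U$ for all $g\in G$. A function $\psi$ (possibly the constant $\infty$) is a limit function of $G$ on $U$ if every sequence in $G$ has some subsequence which converges locally uniformly on $U$ to $\psi$; a constant limit function is identified with its value in $\mathbb{C}\cup\{\infty\}$. A point $\zeta\in\mathbb{C}$ is a fixed point of $G$ if $g(\zeta)=\zeta$ for some $g\in G$. *)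

(* Defs.v *)
From Stdlib Require Import Reals.
From Coquelicot Require Import Coquelicot.

Definition subset (A B : C -> Prop) : Prop := forall z, A z -> B z.

Definition connected (A : C -> Prop) : Prop :=
  forall P Q : C -> Prop,
    open P -> open Q -> subset A (fun z => P z \/ Q z) ->
    (exists z, A z /\ P z) -> (exists z, A z /\ Q z) ->
    exists z, A z /\ P z /\ Q z.

Definition component (F U : C -> Prop) : Prop :=
  (exists z, U z) /\ subset U F /\ connected U /\
  forall W : C -> Prop,
    connected W -> subset W F -> subset U W -> subset W U.

(* Complex differentiability: the scalars are [C_AbsRing], not the reals. *)
Definition holomorphic_on (V : C -> Prop) (f : C -> C) : Prop :=
  forall z, V z -> ex_derive (K := C_AbsRing) (V := C_NormedModule) f z.

Definition entire (f : C -> C) : Prop := holomorphic_on (fun _ => True) f.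

Definition polynomial (f : C -> C) : Prop :=
  exists (d : nat) (a : nat -> C),
    forall z, f z = sum_n (fun k => (a k * z ^ k)%C) d.

Definition transcendental_entire (f : C -> C) : Prop :=
  entire f /\ ~ polynomial f.

(* The semigroup under composition generated by [{g 0, g 1, ...}]. Repetitions
   in [g] are allowed, so finite nonempty families are covered. *)
Inductive semigroup (g : nat -> C -> C) : (C -> C) -> Prop :=
| semigroup_gen : forall i, semigroup g (g i)
| semigroup_comp : forall f h,
    semigroup g f -> semigroup g h -> semigroup g (fun z => f (h z)).

(* Limits take values in the Riemann sphere, but are either finite everywhere
   or identically infinite: [Some psi] is the function [psi], [None] is the
   constant infinity. The values of [psi] outside [V] are irrelevant. *)
Definition cv_locally_uniformly
    (f : nat -> C -> C) (V : C -> Prop) (psi : option (C -> C)) : Prop :=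
  forall z, V z -> exists N : C -> Prop, locally z N /\
    match psi with
    | Some p => forall eps : posreal, eventually (fun n =>
                  forall w, V w -> N w -> (Cmod (f n w - p w) < eps)%R)
    | None => forall M : R, eventually (fun n =>
                  forall w, V w -> N w -> (M < Cmod (f n w))%R)
    end.

Definition strictly_increasing (phi : nat -> nat) : Prop :=
  forall m n, (m < n)%nat -> (phi m < phi n)%nat.

Definition normal_on (G : (C -> C) -> Prop) (V : C -> Prop) : Prop :=
  forall f : nat -> C -> C, (forall n, G (f n)) ->
    exists (phi : nat -> nat) (psi : option (C -> C)),
      strictly_increasing phi /\
      match psi with Some p => holomorphic_on V p | None => True end /\
      cv_locally_uniformly (fun n => f (phi n)) V psi.

(* The union of all open sets on which [G] is normal. Normality is local: on a
   disconnected open set different components may have limits of different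
   kinds (finite on one, infinity on another). *)
Definition Fatou (G : (C -> C) -> Prop) (z : C) : Prop :=
  exists V : C -> Prop, open V /\ normal_on G V /\ V z.

Definition invariant (G : (C -> C) -> Prop) (U : C -> Prop) : Prop :=
  forall h, G h -> forall z, U z -> U (h z).

(* "Every sequence in G" is read as every sequence of pairwise distinct
   elements of [G]. If constant sequences [h, h, h, ...] were admitted, the
   only possible limit function would be [h] itself, for every [h] in [G], and
   no constant could ever be a limit function. *)
Definition limit_function
    (G : (C -> C) -> Prop) (U : C -> Prop) (psi : option (C -> C)) : Prop :=
  forall f : nat -> C -> C,
    (forall n, G (f n)) -> (forall m n, f m = f n -> m = n) ->
    exists phi : nat -> nat,
      strictly_increasing phi /\
      cv_locally_uniformly (fun n => f (phi n)) U psi.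

(* Points of the Riemann sphere: [None] is infinity. *)
Definition constant_function (zeta : option C) : option (C -> C) :=
  option_map (fun (c _ : C) => c) zeta.

Definition fixed_point (G : (C -> C) -> Prop) (c : C) : Prop :=
  exists h, G h /\ h c = c.

(* Main.v *)
(* Let [f = g 0]. If its iterates are pairwise distinct, some subsequence
   [f^(n_k)] tends to the finite constant [c] on [U]; evaluating it at [z0] and at
   [f z0] (both in [U]) and using continuity at [c] gives [f c = c].
   Otherwise [f^m = f^n] with [m < n]. Then [f^(n-m) - id] vanishes on the range of
   [f^m], so by isolation of zeros either [f] is constant or [f^(n-m) = id]. In the
   second case [f] has an entire inverse [phi], and the quotient
   [(z - phi 0) / f z] is a function of [f z], namely the difference quotient of
   [phi] at [0]; it grows at most linearly, hence is affine by Liouville's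
   argument, and [f] is affine. Either way [f] is a polynomial.

   No Taylor expansions are needed: zeros are divided out one at a time at
   distinct points, where the difference quotients are merely continuous, and
   Cauchy's theorem tolerates finitely many such points. *)

Require Import Defs.
From Stdlib Require Import Reals.
From Coquelicot Require Import Coquelicot.
From Stdlib Require Import Lra Lia List Classical ClassicalEpsilon.

(** * Complex differentiability *)

(** The uniform structure is that of the absolute ring, whose balls are the discs of [Cmod]; those
    of the product structure on [R * R] are squares. *)
Definition ccontinuous (f : C -> C) (z : C) : Prop :=
  @continuous (AbsRing_UniformSpace C_AbsRing) (AbsRing_UniformSpace C_AbsRing) f z.

Lemma ccontinuous_eps (f : C -> C) (z : C) :
  ccontinuous f z <->
  forall eps : R, 0 < eps -> exists delta : R, 0 < delta /\
    forall y : C, Cmod (y - z) < delta -> Cmod (f y - f z) < eps.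
Proof.
  unfold ccontinuous, continuous. split.
  - intros H eps Heps.
    pose proof (proj1 (filterlim_locally (U := AbsRing_UniformSpace C_AbsRing) _ _) H
                  (mkposreal eps Heps)) as [d Hd].
    exists d. split; [apply cond_pos | exact Hd].
  - intros H. apply (filterlim_locally (U := AbsRing_UniformSpace C_AbsRing)).
    intros eps. destruct (H eps (cond_pos eps)) as [d [Hd Hy]].
    exists (mkposreal d Hd). exact Hy.
Qed.

Lemma ccontinuous_id (z : C) : ccontinuous (fun y => y) z.
Proof. apply (@continuous_id (AbsRing_UniformSpace C_AbsRing)). Qed.

Lemma ccontinuous_const (c z : C) : ccontinuous (fun _ => c) z.
Proof.
  apply (@continuous_const (AbsRing_UniformSpace C_AbsRing) (AbsRing_UniformSpace C_AbsRing)).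
Qed.

Lemma ccontinuous_plus (f g : C -> C) (z : C) :
  ccontinuous f z -> ccontinuous g z -> ccontinuous (fun y => f y + g y)%C z.
Proof.
  apply (@continuous_plus (AbsRing_UniformSpace C_AbsRing) C_AbsRing
           (AbsRing_NormedModule C_AbsRing)).
Qed.

Lemma ccontinuous_minus (f g : C -> C) (z : C) :
  ccontinuous f z -> ccontinuous g z -> ccontinuous (fun y => f y - g y)%C z.
Proof.
  apply (@continuous_minus (AbsRing_UniformSpace C_AbsRing) C_AbsRing
           (AbsRing_NormedModule C_AbsRing)).
Qed.

Lemma ccontinuous_mult (f g : C -> C) (z : C) :
  ccontinuous f z -> ccontinuous g z -> ccontinuous (fun y => f y * g y)%C z.
Proof.
  apply (@continuous_mult (AbsRing_UniformSpace C_AbsRing) C_AbsRing).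
Qed.

Lemma ccontinuous_comp (f g : C -> C) (z : C) :
  ccontinuous f z -> ccontinuous g (f z) -> ccontinuous (fun y => g (f y)) z.
Proof.
  apply (@continuous_comp (AbsRing_UniformSpace C_AbsRing) (AbsRing_UniformSpace C_AbsRing)
           (AbsRing_UniformSpace C_AbsRing)).
Qed.

Lemma ccontinuous_ext_loc (f g : C -> C) (z : C) (d : R) :
  0 < d -> (forall y, Cmod (y - z) < d -> f y = g y) ->
  ccontinuous f z -> ccontinuous g z.
Proof.
  rewrite !ccontinuous_eps. intros Hd E H eps Heps.
  destruct (H eps Heps) as [d' [Hd' H']].
  exists (Rmin d d'). split; [now apply Rmin_pos |].
  intros y Hy.
  pose proof (Rmin_l d d'). pose proof (Rmin_r d d').
  rewrite <- (E y), <- (E z).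
  - apply H'. lra.
  - replace (z - z)%C with (RtoC 0) by ring. rewrite Cmod_0. exact Hd.
  - lra.
Qed.

Lemma Cminus_neq_0 (x y : C) : x <> y -> (x - y <> 0)%C.
Proof. intros H E. apply H. rewrite <- (Cplus_0_r y), <- E. ring. Qed.

Lemma Cmod_minus_sym (x y : C) : Cmod (x - y) = Cmod (y - x).
Proof. rewrite <- Cmod_opp. f_equal. ring. Qed.

Lemma Cmod_triangle_3 (x y z : C) : Cmod (x - z) <= Cmod (x - y) + Cmod (y - z).
Proof.
  replace (x - z)%C with ((x - y) + (y - z))%C by ring. apply Cmod_triangle.
Qed.

Lemma Cmod_minus_pos (x y : C) : x <> y -> 0 < Cmod (x - y).
Proof. intros H. apply Cmod_gt_0. now apply Cminus_neq_0. Qed.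

Lemma ccontinuous_inv_minus (p z : C) :
  z <> p -> ccontinuous (fun y => / (y - p))%C z.
Proof.
  intros Hzp. apply ccontinuous_eps. intros eps Heps.
  pose proof (Cmod_minus_pos z p Hzp) as Hr.
  set (r := Cmod (z - p)) in *.
  (* The first bound keeps [y] at distance more than [r / 2] from [p], so the difference of the
     inverses is at most [2 * Cmod (y - z) / (r * r)]; the second makes this less than [eps]. *)
  exists (Rmin (r / 2) (eps * (r * r) / 2)).
  split.
  { apply Rmin_pos; [lra|].
    assert (0 < eps * (r * r)) by (repeat apply Rmult_lt_0_compat; lra). lra. }
  intros y Hy.
  pose proof (Rmin_l (r / 2) (eps * (r * r) / 2)).
  pose proof (Rmin_r (r / 2) (eps * (r * r) / 2)).
  pose proof (Cmod_triangle_3 z y p) as T.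
  rewrite (Cmod_minus_sym z y) in T. fold r in T.
  assert (Hyp : r / 2 < Cmod (y - p)) by lra.
  assert (Hne : (y - p <> 0)%C) by (apply Cmod_gt_0; lra).
  assert (Hnz : (z - p <> 0)%C) by now apply Cminus_neq_0.
  replace (/ (y - p) - / (z - p))%C with ((z - y) / ((y - p) * (z - p)))%C
    by (field; auto).
  rewrite Cmod_div by now apply Cmult_neq_0.
  rewrite Cmod_mult, (Cmod_minus_sym z y). fold r.
  apply Rlt_div_l; [apply Rmult_lt_0_compat; lra|].
  assert (0 < eps * r * (Cmod (y - p) - r / 2))
    by (repeat apply Rmult_lt_0_compat; lra).
  lra.
Qed.

(** Carathéodory's form of differentiability, with derivative [phi z]: the rules for differences,
    compositions and quotients by [y - p] become algebra with continuous functions. *)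
Definition cdifferentiable (f : C -> C) (z : C) : Prop :=
  exists phi : C -> C, ccontinuous phi z /\
    forall y, f y = (f z + (y - z) * phi y)%C.

Lemma cdifferentiable_local (f : C -> C) (z : C) (phi : C -> C) (d : R) :
  0 < d -> ccontinuous phi z ->
  (forall y, Cmod (y - z) < d -> f y = (f z + (y - z) * phi y)%C) ->
  cdifferentiable f z.
Proof.
  intros Hd Hphi E.
  exists (fun y => if Rlt_dec (Cmod (y - z)) d then phi y else ((f y - f z) / (y - z))%C).
  split.
  - apply (ccontinuous_ext_loc phi _ z d Hd); [|exact Hphi].
    intros y Hy. destruct (Rlt_dec (Cmod (y - z)) d); [reflexivity | contradiction].
  - intros y. destruct (Rlt_dec (Cmod (y - z)) d) as [H|H]; [now apply E|].
    field. apply Cmod_gt_0. lra.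
Qed.

Lemma ex_derive_cdifferentiable (f : C -> C) (z : C) :
  ex_derive (K := C_AbsRing) (V := C_NormedModule) f z -> cdifferentiable f z.
Proof.
  intros [l [_ Hl]].
  (* The differential is controlled at every limit of the filter [locally z]; the limit chosen is
     [z] itself. *)
  specialize (Hl z (fun P H => H)).
  exists (fun y => if Ceq_dec y z then l else ((f y - f z) / (y - z))%C).
  split.
  - apply ccontinuous_eps. intros eps Heps.
    destruct (Hl (mkposreal (eps / 2) ltac:(lra))) as [d Hd].
    exists d. split; [apply cond_pos|]. intros y Hy.
    destruct (Ceq_dec z z) as [_|n]; [|now contradiction n].
    destruct (Ceq_dec y z) as [_|n].
    + replace (l - l)%C with (RtoC 0) by ring. rewrite Cmod_0. exact Heps.
    + assert (Hne := Cminus_neq_0 y z n).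
      assert (H : Cmod ((f y - f z) - (y - z) * l) <= eps / 2 * Cmod (y - z))
        by exact (Hd y Hy).
      replace ((f y - f z) / (y - z) - l)%C with (((f y - f z) - (y - z) * l) / (y - z))%C
        by (field; exact Hne).
      rewrite Cmod_div by exact Hne.
      pose proof (Cmod_minus_pos y z n).
      apply Rlt_div_l; [lra|]. nra.
  - intros y. destruct (Ceq_dec y z) as [->|n]; [ring|].
    field. now apply Cminus_neq_0.
Qed.

Lemma cdifferentiable_continuous (f : C -> C) (z : C) :
  cdifferentiable f z -> ccontinuous f z.
Proof.
  intros [phi [Hphi E]].
  apply (ccontinuous_ext_loc (fun y => f z + (y - z) * phi y)%C _ z 1 Rlt_0_1).
  - intros y _. now rewrite <- E.
  - apply ccontinuous_plus; [apply ccontinuous_const|].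
    apply ccontinuous_mult; [|exact Hphi].
    apply ccontinuous_minus; [apply ccontinuous_id | apply ccontinuous_const].
Qed.

Lemma cdifferentiable_minus (f g : C -> C) (z : C) :
  cdifferentiable f z -> cdifferentiable g z ->
  cdifferentiable (fun y => f y - g y)%C z.
Proof.
  intros [phi [Hphi Ef]] [psi [Hpsi Eg]].
  exists (fun y => phi y - psi y)%C. split; [now apply ccontinuous_minus|].
  intros y. rewrite (Ef y), (Eg y). ring.
Qed.

Lemma cdifferentiable_id (z : C) : cdifferentiable (fun y => y) z.
Proof.
  exists (fun _ => RtoC 1). split; [apply ccontinuous_const | intros; ring].
Qed.

Lemma cdifferentiable_const (c z : C) : cdifferentiable (fun _ => c) z.
Proof.
  exists (fun _ => RtoC 0). split; [apply ccontinuous_const | intros; ring].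
Qed.

Lemma cdifferentiable_scal (c : C) (f : C -> C) (z : C) :
  cdifferentiable f z -> cdifferentiable (fun y => c * f y)%C z.
Proof.
  intros [phi [Hphi Ef]].
  exists (fun y => c * phi y)%C. split.
  - apply ccontinuous_mult; [apply ccontinuous_const | exact Hphi].
  - intros y. rewrite (Ef y). ring.
Qed.

Lemma cdifferentiable_comp (f g : C -> C) (z : C) :
  cdifferentiable f z -> cdifferentiable g (f z) ->
  cdifferentiable (fun y => g (f y)) z.
Proof.
  intros Hf [psi [Hpsi Eg]]. pose proof (cdifferentiable_continuous f z Hf) as Cf.
  destruct Hf as [phi [Hphi Ef]].
  exists (fun y => phi y * psi (f y))%C. split.
  - apply ccontinuous_mult; [exact Hphi | now apply ccontinuous_comp].
  - intros y. rewrite (Eg (f y)). rewrite (Ef y) at 1. ring.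
Qed.

Lemma cdifferentiable_slope (q : C -> C) (p z l : C) :
  z <> p -> cdifferentiable q z ->
  cdifferentiable (fun y => if Ceq_dec y p then l else (q y - q p) / (y - p))%C z.
Proof.
  intros Hzp [phi [Hphi E]].
  pose proof (Cminus_neq_0 z p Hzp) as Hz.
  (* This is the quotient rule in Carathéodory's form. The radius [Cmod (z - p)] keeps [y] away from
     [p]. *)
  apply (cdifferentiable_local _ z
    (fun y => phi y * / (y - p) - (q z - q p) / (z - p) * / (y - p))%C (Cmod (z - p))).
  - now apply Cmod_minus_pos.
  - apply ccontinuous_minus; apply ccontinuous_mult;
      auto using ccontinuous_inv_minus, ccontinuous_const.
  - intros y Hy.
    destruct (Ceq_dec z p) as [e|_]; [contradiction|].
    destruct (Ceq_dec y p) as [->|n].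
    + rewrite Cmod_minus_sym in Hy. lra.
    + rewrite (E y). pose proof (Cminus_neq_0 y p n). field. auto.
Qed.

(* Continuity everywhere is what makes the exceptional points harmless in
   Cauchy's theorem; difference quotients of such functions stay in the class. *)
Definition entire_off (L : list C) (f : C -> C) : Prop :=
  (forall z, ccontinuous f z) /\ (forall z, ~ In z L -> cdifferentiable f z).

(** The Carathéodory factor of [q] at [p] makes the difference quotient continuous there. Its
    differentiability at [p] would require removal of singularities, so [p] joins the exceptional
    points instead. *)
Lemma slope_entire_off (q : C -> C) (L : list C) (p : C) :
  entire_off L q -> ~ In p L ->
  exists q2, entire_off (p :: L) q2 /\ forall z, q z = (q p + (z - p) * q2 z)%C.
Proof.
  intros [Hc Hd] Hp. destruct (Hd p Hp) as [phi [Hphi E]].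
  set (q2 := fun y => if Ceq_dec y p then phi p else ((q y - q p) / (y - p))%C).
  assert (D : forall z, z <> p -> ~ In z L -> cdifferentiable q2 z).
  { intros z Hz HL. apply cdifferentiable_slope; auto. }
  exists q2. split; [split|].
  - intros z. destruct (Ceq_dec z p) as [->|n].
    + apply (ccontinuous_ext_loc phi _ p 1 Rlt_0_1); [|exact Hphi].
      intros y _. unfold q2. destruct (Ceq_dec y p) as [->|n]; [reflexivity|].
      rewrite (E y). field. now apply Cminus_neq_0.
    + apply (ccontinuous_ext_loc (fun y => (q y - q p) * / (y - p))%C _ z (Cmod (z - p))).
      * now apply Cmod_minus_pos.
      * intros y Hy. unfold q2. destruct (Ceq_dec y p) as [->|n'].
        { rewrite Cmod_minus_sym in Hy. lra. }
        reflexivity.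
      * apply ccontinuous_mult; [|now apply ccontinuous_inv_minus].
        apply ccontinuous_minus; [apply Hc | apply ccontinuous_const].
  - intros z Hz. apply D; intros H; apply Hz; [left | right]; auto.
  - intros z. unfold q2. destruct (Ceq_dec z p) as [->|n]; [ring|].
    field. now apply Cminus_neq_0.
Qed.

(** * Bisection of rectangles *)

Lemma nested_intervals (l r : nat -> R) :
  (forall n, l n <= l (S n)) -> (forall n, r (S n) <= r n) ->
  (forall n, l n <= r n) -> exists u, forall n, l n <= u <= r n.
Proof.
  intros Hl Hr Hlr.
  assert (L : forall n k, l n <= l (n + k)%nat).
  { intros n k. induction k as [|k IH]; [rewrite Nat.add_0_r; lra|].
    rewrite Nat.add_succ_r. specialize (Hl (n + k)%nat). lra. }
  assert (D : forall n k, r (n + k)%nat <= r n).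
  { intros n k. induction k as [|k IH]; [rewrite Nat.add_0_r; lra|].
    rewrite Nat.add_succ_r. specialize (Hr (n + k)%nat). lra. }
  assert (B : forall m n, l m <= r n).
  { intros m n. specialize (L m n). specialize (D n m). specialize (Hlr (m + n)%nat).
    rewrite (Nat.add_comm n m) in D. lra. }
  destruct (completeness (fun x => exists n, x = l n)) as [u [U1 U2]].
  - exists (r 0%nat). intros x [n ->]. apply B.
  - exists (l 0%nat). now exists 0%nat.
  - exists u. intros n. split.
    + apply U1. now exists n.
    + apply U2. intros x [m ->]. apply B.
Qed.

(* [P a c s] is to be read as a property of [[a, a + s w] x [c, c + s h]]. *)
Lemma rectangle_bisection (w h : R) (P : R -> R -> R -> Prop) (a c : R) :
  0 <= w -> 0 <= h ->
  (forall a c s, 0 < s ->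
     P a c (s / 2) -> P (a + s / 2 * w) c (s / 2) ->
     P a (c + s / 2 * h) (s / 2) -> P (a + s / 2 * w) (c + s / 2 * h) (s / 2) ->
     P a c s) ->
  (forall u v, a <= u <= a + w -> c <= v <= c + h -> exists delta, 0 < delta /\
     forall a' c' s, 0 < s < delta -> a' <= u <= a' + s * w ->
       c' <= v <= c' + s * h -> P a' c' s) ->
  P a c 1.
Proof.
  intros Hw Hh Hstep Hloc. apply NNPP. intros Hn.
  set (s := fun n => (/ 2) ^ n).
  assert (Hs : forall n, 0 < s n) by (intros n; apply pow_lt; lra).
  assert (HsS : forall n, s (S n) = s n / 2) by (intros n; unfold s; simpl; lra).
  (* The failure of [P] is a premise inside the existential, so that choice yields a total function
     from corners to corners of a failing quarter. *)
  assert (Hnext : forall n (q : R * R), exists q' : R * R,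
    ~ P (fst q) (snd q) (s n) ->
    (fst q <= fst q' <= fst q + s n / 2 * w /\
     snd q <= snd q' <= snd q + s n / 2 * h /\
     ~ P (fst q') (snd q') (s (S n)))).
  { intros n [x y]. simpl fst. simpl snd. rewrite HsS.
    pose proof (Hs n) as Hp.
    assert (0 <= s n / 2 * w) by (apply Rmult_le_pos; lra).
    assert (0 <= s n / 2 * h) by (apply Rmult_le_pos; lra).
    destruct (classic (P x y (s n / 2))) as [P1|N]; [|exists (x, y); simpl; intuition lra].
    destruct (classic (P (x + s n / 2 * w) y (s n / 2))) as [P2|N];
      [|exists (x + s n / 2 * w, y); simpl; intuition lra].
    destruct (classic (P x (y + s n / 2 * h) (s n / 2))) as [P3|N];
      [|exists (x, y + s n / 2 * h); simpl; intuition lra].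
    destruct (classic (P (x + s n / 2 * w) (y + s n / 2 * h) (s n / 2))) as [P4|N];
      [|exists (x + s n / 2 * w, y + s n / 2 * h); simpl; intuition lra].
    exists (x, y). intros N. exfalso. apply N. now apply Hstep. }
  set (next := fun n q => proj1_sig (constructive_indefinite_description _ (Hnext n q))).
  set (q := fix q n := match n with O => (a, c) | S n => next n (q n) end).
  assert (Hq : forall n, ~ P (fst (q n)) (snd (q n)) (s n)).
  { induction n as [|n IH]; [exact Hn|].
    simpl q. unfold next. destruct (constructive_indefinite_description _ _) as [q' Hq'].
    simpl. now apply Hq'. }
  assert (Hb : forall n,
    fst (q n) <= fst (q (S n)) <= fst (q n) + s n / 2 * w /\
    snd (q n) <= snd (q (S n)) <= snd (q n) + s n / 2 * h).
  { intros n. simpl q. unfold next.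
    destruct (constructive_indefinite_description _ _) as [q' Hq'].
    simpl. destruct (Hq' (Hq n)) as [A [B _]]. now split. }
  destruct (nested_intervals (fun n => fst (q n)) (fun n => fst (q n) + s n * w)) as [u Hu].
  - intros n. apply Hb.
  - intros n. rewrite HsS. destruct (Hb n) as [B _]. nra.
  - intros n. pose proof (Hs n). assert (0 <= s n * w) by (apply Rmult_le_pos; lra). lra.
  - destruct (nested_intervals (fun n => snd (q n)) (fun n => snd (q n) + s n * h)) as [v Hv].
    + intros n. apply Hb.
    + intros n. rewrite HsS. destruct (Hb n) as [_ B]. nra.
    + intros n. pose proof (Hs n). assert (0 <= s n * h) by (apply Rmult_le_pos; lra). lra.
    + destruct (Hloc u v) as [d [Hd HP]].
      * pose proof (Hu 0%nat) as H. simpl in H. unfold s in H. simpl in H. lra.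
      * pose proof (Hv 0%nat) as H. simpl in H. unfold s in H. simpl in H. lra.
      (* The point [(u, v)] lies in all the chosen rectangles; once their scale is below [d], the
         local hypothesis contradicts the failure of [P]. *)
      * destruct (pow_lt_1_zero (/ 2) ltac:(rewrite Rabs_pos_eq; lra) d Hd) as [N HN].
        specialize (HN N (Nat.le_refl N)).
        rewrite Rabs_pos_eq in HN by (apply pow_le; lra).
        apply (Hq N). apply HP; [split; [apply Hs | exact HN] | apply Hu | apply Hv].
Qed.

(** * Cauchy's theorem for rectangles *)

Lemma im_le_Cmod (z : C) : Rabs (Im z) <= Cmod z.
Proof.
  destruct z as [x y]. eapply Rle_trans; [|apply Rmax_Cmod]. apply Rmax_r.
Qed.

Lemma Cmod_le_abs (x y : R) : Cmod (x, y) <= Rabs x + Rabs y.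
Proof.
  replace (x, y) with (RtoC x + Ci * RtoC y)%C
    by (unfold RtoC, Ci, Cplus, Cmult; simpl; f_equal; ring).
  eapply Rle_trans; [apply Cmod_triangle|].
  rewrite Cmod_mult, Cmod_Ci, !Cmod_R. lra.
Qed.

Lemma continuous_horizontal (f : C -> C) (y x : R) :
  (forall z, ccontinuous f z) -> continuous (fun t => Re (f (t, y))) x.
Proof.
  intros Hf. apply filterlim_locally. intros eps.
  destruct (proj1 (ccontinuous_eps f (x, y)) (Hf _) eps (cond_pos eps)) as [d [Hd H]].
  exists (mkposreal d Hd). intros t Ht.
  assert (Ht' : Rabs (t - x) < d) by exact Ht.
  change (Rabs (Re (f (t, y)) - Re (f (x, y))) < eps).
  eapply Rle_lt_trans; [apply (re_le_Cmod (f (t, y) - f (x, y)))|].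
  apply H. replace ((t, y) - (x, y))%C with (RtoC (t - x)).
  - now rewrite Cmod_R.
  - unfold RtoC, Cminus, Cplus, Copp; simpl; f_equal; ring.
Qed.

Lemma continuous_vertical (f : C -> C) (x y : R) :
  (forall z, ccontinuous f z) -> continuous (fun t => Im (f (x, t))) y.
Proof.
  intros Hf. apply filterlim_locally. intros eps.
  destruct (proj1 (ccontinuous_eps f (x, y)) (Hf _) eps (cond_pos eps)) as [d [Hd H]].
  exists (mkposreal d Hd). intros t Ht.
  assert (Ht' : Rabs (t - y) < d) by exact Ht.
  change (Rabs (Im (f (x, t)) - Im (f (x, y))) < eps).
  eapply Rle_lt_trans; [apply (im_le_Cmod (f (x, t) - f (x, y)))|].
  apply H. replace ((x, t) - (x, y))%C with (Ci * RtoC (t - y))%C.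
  - rewrite Cmod_mult, Cmod_Ci, Cmod_R. lra.
  - unfold RtoC, Ci, Cminus, Cmult, Cplus, Copp; simpl; f_equal; ring.
Qed.

(** On vertical segments [dz] is [i dy], and the real part of [i * f] is minus the imaginary part of
    [f]; hence [Im] in [vint] and its signs in [boundary_int]. *)
Definition hint (f : C -> C) (y a b : R) : R := RInt (fun x => Re (f (x, y))) a b.
Definition vint (f : C -> C) (x c d : R) : R := RInt (fun y => Im (f (x, y))) c d.

(* The real part of the integral of [f dz] along the boundary of
   [[a, b] x [c, d]], oriented counterclockwise. *)
Definition boundary_int (f : C -> C) (a b c d : R) : R :=
  hint f c a b - hint f d a b - vint f b c d + vint f a c d.

Lemma ex_hint (f : C -> C) (Hf : forall z, ccontinuous f z) (y a b : R) :
  ex_RInt (fun x => Re (f (x, y))) a b.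
Proof.
  apply (ex_RInt_continuous (V := R_CompleteNormedModule)).
  intros x _. now apply continuous_horizontal.
Qed.

Lemma ex_vint (f : C -> C) (Hf : forall z, ccontinuous f z) (x c d : R) :
  ex_RInt (fun y => Im (f (x, y))) c d.
Proof.
  apply (ex_RInt_continuous (V := R_CompleteNormedModule)).
  intros y _. now apply continuous_vertical.
Qed.

Lemma boundary_int_split_x (f : C -> C) (Hf : forall z, ccontinuous f z) (a e b c d : R) :
  boundary_int f a b c d = boundary_int f a e c d + boundary_int f e b c d.
Proof.
  assert (H : forall y, hint f y a b = hint f y a e + hint f y e b).
  { intros y. symmetry. apply (RInt_Chasles (V := R_CompleteNormedModule)); now apply ex_hint. }
  unfold boundary_int. rewrite !H. ring.
Qed.

Lemma boundary_int_split_y (f : C -> C) (Hf : forall z, ccontinuous f z) (a b c e d : R) :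
  boundary_int f a b c d = boundary_int f a b c e + boundary_int f a b e d.
Proof.
  assert (H : forall x, vint f x c d = vint f x c e + vint f x e d).
  { intros x. symmetry. apply (RInt_Chasles (V := R_CompleteNormedModule)); now apply ex_vint. }
  unfold boundary_int. rewrite !H. ring.
Qed.

Lemma boundary_int_bound (f : C -> C) (Hf : forall z, ccontinuous f z) (a b c d M : R) :
  a <= b -> c <= d ->
  (forall x y, a <= x <= b -> c <= y <= d -> Cmod (f (x, y)) <= M) ->
  Rabs (boundary_int f a b c d) <= 2 * ((b - a) + (d - c)) * M.
Proof.
  intros Hab Hcd HM.
  assert (H : forall y, c <= y <= d -> Rabs (hint f y a b) <= (b - a) * M).
  { intros y Hy. apply abs_RInt_le_const; [exact Hab | now apply ex_hint |].
    intros t Ht. eapply Rle_trans; [apply re_le_Cmod | now apply HM]. }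
  assert (V : forall x, a <= x <= b -> Rabs (vint f x c d) <= (d - c) * M).
  { intros x Hx. apply abs_RInt_le_const; [exact Hcd | now apply ex_vint |].
    intros t Ht. eapply Rle_trans; [apply im_le_Cmod | now apply HM]. }
  pose proof (proj1 (Rabs_le_between _ _) (H c ltac:(lra))).
  pose proof (proj1 (Rabs_le_between _ _) (H d ltac:(lra))).
  pose proof (proj1 (Rabs_le_between _ _) (V a ltac:(lra))).
  pose proof (proj1 (Rabs_le_between _ _) (V b ltac:(lra))).
  apply Rabs_le_between. unfold boundary_int. lra.
Qed.

Lemma boundary_int_minus (f g : C -> C) (a b c d : R) :
  (forall z, ccontinuous f z) -> (forall z, ccontinuous g z) ->
  boundary_int (fun z => f z - g z)%C a b c d
  = boundary_int f a b c d - boundary_int g a b c d.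
Proof.
  intros Hf Hg.
  assert (H : forall y, hint (fun z => f z - g z)%C y a b = hint f y a b - hint g y a b).
  { intros y. apply (RInt_minus (V := R_CompleteNormedModule)
      (fun x => Re (f (x, y))) (fun x => Re (g (x, y)))); now apply ex_hint. }
  assert (V : forall x, vint (fun z => f z - g z)%C x c d = vint f x c d - vint g x c d).
  { intros x. apply (RInt_minus (V := R_CompleteNormedModule)
      (fun y => Im (f (x, y))) (fun y => Im (g (x, y)))); now apply ex_vint. }
  unfold boundary_int. rewrite !H, !V. ring.
Qed.

(** On opposite sides the integrands differ by a constant; each pair of sides yields the area times
    [Im B], and the two pairs enter with opposite signs. *)
Lemma boundary_int_affine (A B : C) (a b c d : R) :
  boundary_int (fun z => A + z * B)%C a b c d = 0.
Proof.
  assert (Hc : forall z, ccontinuous (fun z => A + z * B)%C z).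
  { intros z. apply ccontinuous_plus; [apply ccontinuous_const|].
    apply ccontinuous_mult; [apply ccontinuous_id | apply ccontinuous_const]. }
  set (g := fun z => (A + z * B)%C) in *.
  assert (H : hint g c a b - hint g d a b = (b - a) * ((d - c) * Im B)).
  { transitivity (RInt (fun x => minus (Re (g (x, c))) (Re (g (x, d)))) a b).
    - symmetry. exact (RInt_minus (V := R_CompleteNormedModule) _ _ a b
        (ex_hint g Hc c a b) (ex_hint g Hc d a b)).
    - transitivity (RInt (fun _ => (d - c) * Im B) a b).
      + apply RInt_ext. intros x _. unfold g, minus, plus, opp, Re, Im; simpl. ring.
      + exact (RInt_const (V := R_CompleteNormedModule) a b _). }
  assert (V : vint g b c d - vint g a c d = (d - c) * ((b - a) * Im B)).
  { transitivity (RInt (fun y => minus (Im (g (b, y))) (Im (g (a, y)))) c d).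
    - symmetry. exact (RInt_minus (V := R_CompleteNormedModule) _ _ c d
        (ex_vint g Hc b c d) (ex_vint g Hc a c d)).
    - transitivity (RInt (fun _ => (b - a) * Im B) c d).
      + apply RInt_ext. intros x _. unfold g, minus, plus, opp, Re, Im; simpl. ring.
      + exact (RInt_const (V := R_CompleteNormedModule) c d _). }
  unfold boundary_int. lra.
Qed.

Lemma Rabs_small_eq_0 (x : R) : (forall eps, 0 < eps -> Rabs x <= eps) -> x = 0.
Proof.
  intros H. destruct (Req_dec x 0) as [|n]; [assumption|].
  pose proof (Rabs_pos_lt x n). specialize (H (Rabs x / 2) ltac:(lra)). lra.
Qed.

(** The bound [eps * (s * s)] at scale [s] passes from the four quarters to the whole because four
    times [(s / 2)^2] is [s^2]. Near a point, subtracting the tangent affine function leaves a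
    remainder small compared to the diameter, integrated over a perimeter of order [s]. *)
Lemma goursat (f : C -> C) (a b c d : R) :
  (forall z, ccontinuous f z) -> a <= b -> c <= d ->
  (forall x y, a <= x <= b -> c <= y <= d -> cdifferentiable f (x, y)) ->
  boundary_int f a b c d = 0.
Proof.
  intros Hf Hab Hcd Hdiff. apply Rabs_small_eq_0. intros eps Heps.
  set (w := b - a). set (h := d - c).
  assert (Hw : 0 <= w) by (unfold w; lra).
  assert (Hh : 0 <= h) by (unfold h; lra).
  set (P := fun x y s => Rabs (boundary_int f x (x + s * w) y (y + s * h)) <= eps * (s * s)).
  assert (HP : P a c 1).
  { apply (rectangle_bisection w h P); [exact Hw | exact Hh | |].
    - intros x y s Hs. unfold P. intros P1 P2 P3 P4.
      rewrite (boundary_int_split_x f Hf x (x + s / 2 * w) (x + s * w)).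
      rewrite (boundary_int_split_y f Hf x _ y (y + s / 2 * h) (y + s * h)).
      rewrite (boundary_int_split_y f Hf (x + s / 2 * w) _ y (y + s / 2 * h) (y + s * h)).
      replace (x + s / 2 * w + s / 2 * w) with (x + s * w) in P2, P4 by field.
      replace (y + s / 2 * h + s / 2 * h) with (y + s * h) in P3, P4 by field.
      apply Rabs_le_between. apply Rabs_le_between in P1, P2, P3, P4. lra.
    - intros u v Hu Hv.
      destruct (Hdiff u v ltac:(unfold w in Hu; lra) ltac:(unfold h in Hv; lra))
        as [phi [Hphi E]].
      (* At scale [s] the perimeter is at most [2 * s * K] and the distance to [(u, v)] at most
         [s * K], so a tolerance [eps / (2 * K * K)] on [phi] gives [eps * (s * s)]. The summand 1
         keeps [K] positive for degenerate rectangles. *)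
      set (K := w + h + 1). assert (HK : 0 < K) by (unfold K; lra).
      destruct (proj1 (ccontinuous_eps phi _) Hphi (eps / (2 * K * K))) as [r [Hr Hball]].
      { apply Rdiv_lt_0_compat; [lra|]. repeat apply Rmult_lt_0_compat; lra. }
      exists (r / K). split; [now apply Rdiv_lt_0_compat|].
      intros x y s [Hs Hsr] Hx Hy. unfold P.
      assert (HsK : s * K < r) by now apply Rlt_div_r.
      assert (Hsw : 0 <= s * w) by (apply Rmult_le_pos; lra).
      assert (Hsh : 0 <= s * h) by (apply Rmult_le_pos; lra).
      set (p := (u, v) : C) in *.
      set (A := (f p - p * phi p)%C).
      assert (HA : forall z, ccontinuous (fun z => A + z * phi p)%C z).
      { intros z. apply ccontinuous_plus; [apply ccontinuous_const|].
        apply ccontinuous_mult; [apply ccontinuous_id | apply ccontinuous_const]. }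
      pose proof (boundary_int_minus f (fun z => A + z * phi p)%C
        x (x + s * w) y (y + s * h) Hf HA) as HJ.
      rewrite boundary_int_affine, Rminus_0_r in HJ. rewrite <- HJ.
      eapply Rle_trans.
      + apply (boundary_int_bound _ (fun z => ccontinuous_minus _ _ z (Hf z) (HA z)) _ _ _ _
          (s * K * (eps / (2 * K * K)))); [lra | lra |].
        intros x' y' Hx' Hy'.
        assert (Hd : Cmod ((x', y') - p) <= s * K).
        { unfold p. change ((x', y') - (u, v))%C with (x' - u, y' - v).
          eapply Rle_trans; [apply Cmod_le_abs|].
          assert (Rabs (x' - u) <= s * w) by (apply Rabs_le_between; lra).
          assert (Rabs (y' - v) <= s * h) by (apply Rabs_le_between; lra).
          unfold K. lra. }
        replace (f (x', y') - (A + (x', y') * phi p))%C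
          with (((x', y') - p) * (phi (x', y') - phi p))%C
          by (unfold A; rewrite (E (x', y')); ring).
        rewrite Cmod_mult.
        apply Rmult_le_compat; [apply Cmod_ge_0 | apply Cmod_ge_0 | exact Hd |].
        apply Rlt_le, Hball. lra.
      + replace (eps * (s * s)) with (2 * (s * K) * (s * K * (eps / (2 * K * K))))
          by (field; lra).
        apply Rmult_le_compat_r.
        * repeat apply Rmult_le_pos; try lra. apply Rlt_le, Rinv_0_lt_compat.
          repeat apply Rmult_lt_0_compat; lra.
        * unfold K. lra. }
  unfold P in HP. replace (a + 1 * w) with b in HP by (unfold w; ring).
  replace (c + 1 * h) with d in HP by (unfold h; ring). lra.
Qed.

Lemma boundary_int_degenerate_x (f : C -> C) (a c d : R) : boundary_int f a a c d = 0.
Proof.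
  unfold boundary_int, hint. rewrite !RInt_point. unfold zero; simpl. ring.
Qed.

Lemma boundary_int_degenerate_y (f : C -> C) (a b c : R) : boundary_int f a b c c = 0.
Proof.
  unfold boundary_int, vint. rewrite !RInt_point. unfold zero; simpl. ring.
Qed.

(** The closing disjunctions say that the piece cut off on either side is degenerate or misses [p]:
    in both cases its contribution to the boundary integral will vanish. *)
Lemma interval_around (a b p eta : R) :
  a <= p <= b -> 0 < eta ->
  exists a' b', a <= a' <= p /\ p <= b' <= b /\ p - eta <= a' /\ b' <= p + eta /\
    (a = a' \/ a' < p) /\ (b' = b \/ p < b').
Proof.
  intros Hp He. exists (Rmax a (p - eta)), (Rmin b (p + eta)).
  unfold Rmax, Rmin.
  destruct (Rle_dec a (p - eta)), (Rle_dec b (p + eta)); repeat split; try lra;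
    first [left; lra | right; lra | idtac].
Qed.

(* Each exceptional point is cut out by a small square, whose contribution is at
   most its perimeter times a local bound of [f]. *)
Lemma goursat_off (f : C -> C) (L : list C) :
  (forall z, ccontinuous f z) ->
  forall a b c d, a <= b -> c <= d ->
  (forall x y, a <= x <= b -> c <= y <= d -> ~ In (x, y) L -> cdifferentiable f (x, y)) ->
  boundary_int f a b c d = 0.
Proof.
  intros Hf. induction L as [|[p1 p2] L IH]; intros a b c d Hab Hcd Hdiff.
  { apply goursat; auto. }
  assert (Hsub : forall a' b' c' d', a <= a' <= b' -> b' <= b -> c <= c' <= d' -> d' <= d ->
    (a' = b' \/ c' = d' \/ p1 < a' \/ b' < p1 \/ p2 < c' \/ d' < p2) ->
    boundary_int f a' b' c' d' = 0).
  { intros a' b' c' d' Ha' Hb' Hc' Hd' [->|[->|Hp]].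
    - apply boundary_int_degenerate_x.
    - apply boundary_int_degenerate_y.
    - apply IH; [lra | lra |]. intros x y Hx Hy HL. apply Hdiff; [lra | lra |].
      intros [E|E]; [|contradiction]. injection E. intros. lra. }
  destruct (classic (a <= p1 <= b /\ c <= p2 <= d)) as [[H1 H2]|Hn].
  (* The exceptional point is outside, so the rectangle itself is covered by [Hsub]. *)
  2:{ destruct (Rlt_dec p1 a), (Rlt_dec b p1), (Rlt_dec p2 c), (Rlt_dec d p2);
        apply Hsub; lra. }
  apply Rabs_small_eq_0. intros eps Heps.
  set (p := (p1, p2) : C) in *.
  set (M := Cmod (f p) + 1).
  assert (HM : 0 < M) by (pose proof (Cmod_ge_0 (f p)); unfold M; lra).
  destruct (proj1 (ccontinuous_eps f p) (Hf p) 1 Rlt_0_1) as [r [Hr Hball]].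
  (* The bound [r / 3] keeps the square inside the disc where [M] bounds [f]; the other makes
     perimeter times bound, at most [8 * eta * M], no larger than [eps]. *)
  set (eta := Rmin (r / 3) (eps / (8 * M))).
  assert (Heta : 0 < eta).
  { apply Rmin_pos; [lra|]. apply Rdiv_lt_0_compat; lra. }
  assert (E1 : eta <= r / 3) by apply Rmin_l.
  assert (E2 : eta <= eps / (8 * M)) by apply Rmin_r.
  destruct (interval_around a b p1 eta H1 Heta) as (a' & b' & A1 & A2 & A3 & A4 & A5 & A6).
  destruct (interval_around c d p2 eta H2 Heta) as (c' & d' & C1 & C2 & C3 & C4 & C5 & C6).
  rewrite (boundary_int_split_x f Hf a a' b).
  rewrite (boundary_int_split_x f Hf a' b' b).
  rewrite (boundary_int_split_y f Hf a' b' c c' d).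
  rewrite (boundary_int_split_y f Hf a' b' c' d' d).
  rewrite (Hsub a a' c d) by lra.
  rewrite (Hsub b' b c d) by lra.
  rewrite (Hsub a' b' c c') by lra.
  rewrite (Hsub a' b' d' d) by lra.
  replace (0 + (0 + (boundary_int f a' b' c' d' + 0) + 0))
    with (boundary_int f a' b' c' d') by ring.
  eapply Rle_trans.
  - apply (boundary_int_bound f Hf a' b' c' d' M); [lra | lra |].
    intros x y Hx Hy.
    assert (Hd : Cmod ((x, y) - p) < r).
    { unfold p. change ((x, y) - (p1, p2))%C with (x - p1, y - p2).
      eapply Rle_lt_trans; [apply Cmod_le_abs|].
      assert (Rabs (x - p1) <= eta) by (apply Rabs_le_between; lra).
      assert (Rabs (y - p2) <= eta) by (apply Rabs_le_between; lra).
      lra. }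
    apply Hball in Hd.
    pose proof (Cmod_triangle (f (x, y) - f p) (f p)) as T.
    replace (f (x, y) - f p + f p)%C with (f (x, y)) in T by ring.
    unfold M. lra.
  - apply Rle_trans with (2 * (2 * eta + 2 * eta) * M).
    + apply Rmult_le_compat_r; lra.
    + apply Rle_div_r in E2; lra.
Qed.

(** * Entire functions with exceptional points *)

(** Compactness by bisection of the enclosing square: boundedness passes from the quarters to the
    whole, and continuity provides it locally. *)
Lemma bounded_on_disk (f : C -> C) (w : C) (r : R) :
  (forall z, ccontinuous f z) ->
  exists M, forall z, Cmod (z - w) <= r -> Cmod (f z) <= M.
Proof.
  intros Hf. destruct w as [u v].
  set (h := 2 * Rabs r).
  pose proof (Rabs_pos r) as Hr. pose proof (Rle_abs r).
  set (P := fun x y s => exists M, forall x' y',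
    x <= x' <= x + s * h -> y <= y' <= y + s * h -> Cmod (f (x', y')) <= M).
  assert (HP : P (u - Rabs r) (v - Rabs r) 1).
  { apply (rectangle_bisection h h P); [unfold h; lra | unfold h; lra | |].
    - intros x y s Hs [M1 P1] [M2 P2] [M3 P3] [M4 P4].
      exists (Rmax (Rmax M1 M2) (Rmax M3 M4)). intros x' y' Hx Hy.
      pose proof (Rmax_l (Rmax M1 M2) (Rmax M3 M4)).
      pose proof (Rmax_r (Rmax M1 M2) (Rmax M3 M4)).
      pose proof (Rmax_l M1 M2). pose proof (Rmax_r M1 M2).
      pose proof (Rmax_l M3 M4). pose proof (Rmax_r M3 M4).
      destruct (Rle_dec x' (x + s / 2 * h)), (Rle_dec y' (y + s / 2 * h)).
      + specialize (P1 x' y' ltac:(lra) ltac:(lra)). lra.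
      + specialize (P3 x' y' ltac:(lra) ltac:(lra)). lra.
      + specialize (P2 x' y' ltac:(lra) ltac:(lra)). lra.
      + specialize (P4 x' y' ltac:(lra) ltac:(lra)). lra.
    - intros x0 y0 _ _.
      destruct (proj1 (ccontinuous_eps f (x0, y0)) (Hf _) 1 Rlt_0_1) as [d [Hd Hb]].
      exists (d / (2 * h + 1)). split; [apply Rdiv_lt_0_compat; unfold h; lra|].
      intros x y s [Hs Hsd] Hx Hy. exists (Cmod (f (x0, y0)) + 1).
      intros x' y' Hx' Hy'.
      assert (Hsd' : s * (2 * h + 1) < d) by (apply Rlt_div_r; unfold h in *; lra).
      assert (Hd' : Cmod ((x', y') - (x0, y0)) < d).
      { change ((x', y') - (x0, y0))%C with (x' - x0, y' - y0).
        eapply Rle_lt_trans; [apply Cmod_le_abs|].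
        assert (Rabs (x' - x0) <= s * h) by (apply Rabs_le_between; lra).
        assert (Rabs (y' - y0) <= s * h) by (apply Rabs_le_between; lra). lra. }
      apply Hb in Hd'.
      pose proof (Cmod_triangle (f (x', y') - f (x0, y0)) (f (x0, y0))) as T.
      replace (f (x', y') - f (x0, y0) + f (x0, y0))%C with (f (x', y')) in T by ring.
      lra. }
  destruct HP as [M HM]. exists M. intros [x y] Hz.
  pose proof (re_le_Cmod ((x, y) - (u, v))) as H1.
  pose proof (im_le_Cmod ((x, y) - (u, v))) as H2.
  change (Re ((x, y) - (u, v))) with (x - u) in H1.
  change (Im ((x, y) - (u, v))) with (y - v) in H2.
  pose proof (Rle_trans _ _ _ H1 Hz) as H1'. apply Rabs_le_between in H1'.
  pose proof (Rle_trans _ _ _ H2 Hz) as H2'. apply Rabs_le_between in H2'.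
  apply HM; unfold h; lra.
Qed.

(** * Cauchy's estimate on a square *)

Lemma RInt_le_const (f : R -> R) (a b M : R) :
  a <= b -> ex_RInt f a b -> (forall t, a <= t <= b -> f t <= M) ->
  RInt f a b <= (b - a) * M.
Proof.
  intros Hab Hf HM.
  rewrite <- (RInt_const (V := R_CompleteNormedModule) a b M : _ = (b - a) * M).
  apply RInt_le; [exact Hab | exact Hf | apply ex_RInt_const |].
  intros t Ht. apply HM. lra.
Qed.

Lemma RInt_ge_const (f : R -> R) (a b M : R) :
  a <= b -> ex_RInt f a b -> (forall t, a <= t <= b -> M <= f t) ->
  (b - a) * M <= RInt f a b.
Proof.
  intros Hab Hf HM.
  rewrite <- (RInt_const (V := R_CompleteNormedModule) a b M : _ = (b - a) * M).
  apply RInt_le; [exact Hab | apply ex_RInt_const | exact Hf |].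
  intros t Ht. apply HM. lra.
Qed.

Lemma Cmod_sqr (x y : R) : Cmod (x, y) * Cmod (x, y) = x * x + y * y.
Proof.
  pose proof (Cmod2_alt (x, y)) as H. simpl in H. unfold Re, Im in H. simpl in H. lra.
Qed.

Lemma sqr_le_inv (a b : R) : 0 <= b -> a * a <= b * b -> a <= b.
Proof. intros. nra. Qed.

(** On a side of the square of half-side [r], the squared distance to the centre is at most
    [2 * r^2]. *)
Lemma frac_ge_half (x y r K : R) :
  0 < r -> 0 <= K -> y = r -> Rabs x <= r -> K / (2 * r) <= K * y / (x * x + y * y).
Proof.
  intros Hr HK -> Hx. apply Rabs_le_between in Hx.
  assert (0 <= (r - x) * (r + x)) by (apply Rmult_le_pos; lra).
  assert (0 < r * r) by (apply Rmult_lt_0_compat; lra).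
  assert (Hn : 0 < x * x + r * r) by nra.
  apply (Rle_div_r _ _ _ Hn).
  apply Rle_trans with (K / (2 * r) * (2 * (r * r))).
  - apply Rmult_le_compat_l; [|lra].
    apply Rdiv_le_0_compat; lra.
  - right. field. lra.
Qed.

(* Cauchy's theorem for [(q z - q w) / (z - w)] on the boundary of the square of
   half-side [r] around [w]; the real part of the integral of [dz / (z - w)],
   rotated by [-i], is bounded below pointwise, so it need not be computed.
   This explains the factor [2]. *)
Lemma cauchy_estimate (q : C -> C) (L : list C) (w : C) (r M : R) :
  entire_off L q -> ~ In w L -> 0 < r ->
  (forall z, r <= Cmod (z - w) <= 2 * r -> Cmod (q z) <= M) ->
  Cmod (q w) <= 2 * M.
Proof.
  intros [Hc Hd] Hw Hr HM.
  destruct (Req_dec (Cmod (q w)) 0) as [H0|Hne].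
  (* Here [M] must still be shown nonnegative, by evaluating the hypothesis at one point. *)
  { rewrite H0. specialize (HM (w + RtoC r)%C).
    replace (w + RtoC r - w)%C with (RtoC r) in HM by ring.
    rewrite Cmod_R, Rabs_pos_eq in HM by lra.
    specialize (HM ltac:(lra)). pose proof (Cmod_ge_0 (q (w + RtoC r)%C)). lra. }
  pose proof (Cmod_ge_0 (q w)).
  set (k := Cmod (q w)) in *. assert (Hk : 0 < k) by lra.
  (* This factor turns [q w] into [- i * k^2]. The slope [p] then contains [i * k^2 / (z - w)],
     whose real part has constant sign on each horizontal side and whose imaginary part has constant
     sign on each vertical side. *)
  set (lam := (- Ci * Cconj (q w))%C).
  assert (Hlam : Cmod lam = k).
  { unfold lam. rewrite Cmod_mult, Cmod_opp, Cmod_Ci, Cmod_conj. unfold k. ring. }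
  assert (Hlq : (lam * q w)%C = (0, - (k * k))).
  { unfold lam, k. destruct (q w) as [x y].
    rewrite Cmod_sqr. unfold Ci, Cconj, Cmult, Copp; simpl. f_equal; ring. }
  assert (Hgood : entire_off L (fun z => lam * q z)%C).
  { split.
    - intros z. apply ccontinuous_mult; [apply ccontinuous_const | apply Hc].
    - intros z Hz. apply cdifferentiable_scal. auto. }
  destruct (slope_entire_off _ L w Hgood Hw) as [p [[Hpc Hpd] Hp]].
  destruct w as [u v].
  pose proof (goursat_off p ((u, v) :: L) Hpc (u - r) (u + r) (v - r) (v + r)
    ltac:(lra) ltac:(lra) (fun x y _ _ HL => Hpd (x, y) HL)) as H0.
  (* This bounds the rest of the slope, [lam * q z / (z - w)], on the boundary of the square. *)
  set (e := k * M / r).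
  assert (Hpt : forall x y, Rabs (x - u) <= r -> Rabs (y - v) <= r ->
    r * r <= (x - u) * (x - u) + (y - v) * (y - v) ->
    let n := (x - u) * (x - u) + (y - v) * (y - v) in
    Rabs (Re (p (x, y)) - k * k * (y - v) / n) <= e /\
    Rabs (Im (p (x, y)) - k * k * (x - u) / n) <= e).
  { intros x y Hx Hy Hn n.
    assert (Hrr : 0 < r * r) by now apply Rmult_lt_0_compat.
    set (s := k * k * (y - v) / n). set (t := k * k * (x - u) / n).
    set (zeta := ((x, y) - (u, v))%C).
    assert (Hz : zeta = (x - u, y - v)) by reflexivity.
    assert (Hm : Cmod zeta * Cmod zeta = n) by (rewrite Hz; apply Cmod_sqr).
    assert (Hm1 : r <= Cmod zeta).
    { apply sqr_le_inv; [apply Cmod_ge_0|]. rewrite Hm. exact Hn. }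
    assert (Hm2 : Cmod zeta <= 2 * r).
    { rewrite Hz. eapply Rle_trans; [apply Cmod_le_abs|]. lra. }
    assert (Hz0 : zeta <> 0%C) by (apply Cmod_gt_0; lra).
    assert (E : (p (x, y) - (s, t))%C
                = (lam * q (x, y) / zeta)%C).
    { rewrite (Hp (x, y)), Hlq. fold zeta.
      replace ((0, (- (k * k))%R) + zeta * p (x, y))%C
        with (zeta * (p (x, y) - (s, t)))%C.
      - field. exact Hz0.
      - replace (zeta * (p (x, y) - (s, t)))%C
          with (zeta * p (x, y)
                - zeta * (s, t))%C by ring.
        replace (zeta * (s, t))%C
          with ((0, (k * k)%R) : C).
        + unfold Cminus. rewrite Cplus_comm. f_equal.
          unfold Copp; simpl. f_equal. ring.
        + rewrite Hz. unfold Cmult; simpl. f_equal; unfold s, t, n in *; field; lra. }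
    assert (HB : Cmod (p (x, y) - (s, t)) <= e).
    { rewrite E, Cmod_div by exact Hz0. rewrite Cmod_mult, Hlam.
      specialize (HM (x, y) (conj Hm1 Hm2)).
      apply Rle_div_l; [lra|].
      apply Rle_trans with (k * M).
      - apply Rmult_le_compat_l; lra.
      - unfold e. replace (k * M) with (k * M / r * r) at 1 by (field; lra).
        apply Rmult_le_compat_l; [|exact Hm1].
        pose proof (Cmod_ge_0 (q (x, y))).
        apply Rdiv_le_0_compat; [apply Rmult_le_pos; lra | exact Hr]. }
    split; eapply Rle_trans; try exact HB.
    - apply (re_le_Cmod (p (x, y) - (s, t))).
    - apply (im_le_Cmod (p (x, y) - (s, t))). }
  assert (Hkk : 0 <= k * k) by (apply Rmult_le_pos; lra).
  set (B := k * k / (2 * r) - e).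
  assert (Bottom : hint p (v - r) (u - r) (u + r) <= (u + r - (u - r)) * - B).
  { apply RInt_le_const; [lra | now apply ex_hint |]. intros t Ht.
    assert (Hx : Rabs (t - u) <= r) by (apply Rabs_le_between; lra).
    destruct (Hpt t (v - r)) as [HR _];
      [exact Hx | apply Rabs_le_between; lra |
       pose proof (Rle_0_sqr (t - u)) as S; unfold Rsqr in S; lra |].
    apply Rabs_le_between in HR.
    pose proof (frac_ge_half (t - u) r r (k * k) Hr Hkk eq_refl Hx) as F.
    replace (v - r - v) with (- r) in HR by ring.
    replace (- r * - r) with (r * r) in HR by ring.
    unfold Rdiv in *. rewrite Ropp_mult_distr_r_reverse, Ropp_mult_distr_l_reverse in HR.
    unfold B, Rdiv. lra. }
  assert (Top : (u + r - (u - r)) * B <= hint p (v + r) (u - r) (u + r)).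
  { apply RInt_ge_const; [lra | now apply ex_hint |]. intros t Ht.
    assert (Hx : Rabs (t - u) <= r) by (apply Rabs_le_between; lra).
    destruct (Hpt t (v + r)) as [HR _];
      [exact Hx | apply Rabs_le_between; lra |
       pose proof (Rle_0_sqr (t - u)) as S; unfold Rsqr in S; lra |].
    apply Rabs_le_between in HR.
    pose proof (frac_ge_half (t - u) r r (k * k) Hr Hkk eq_refl Hx) as F.
    replace (v + r - v) with r in HR by ring.
    unfold B. lra. }
  assert (Right : (v + r - (v - r)) * B <= vint p (u + r) (v - r) (v + r)).
  { apply RInt_ge_const; [lra | now apply ex_vint |]. intros t Ht.
    assert (Hy : Rabs (t - v) <= r) by (apply Rabs_le_between; lra).
    destruct (Hpt (u + r) t) as [_ HI];
      [apply Rabs_le_between; lra | exact Hy |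
       pose proof (Rle_0_sqr (t - v)) as S; unfold Rsqr in S; lra |].
    apply Rabs_le_between in HI.
    pose proof (frac_ge_half (t - v) r r (k * k) Hr Hkk eq_refl Hy) as F.
    replace (u + r - u) with r in HI by ring.
    rewrite (Rplus_comm (r * r)) in HI.
    unfold B. lra. }
  assert (Left : vint p (u - r) (v - r) (v + r) <= (v + r - (v - r)) * - B).
  { apply RInt_le_const; [lra | now apply ex_vint |]. intros t Ht.
    assert (Hy : Rabs (t - v) <= r) by (apply Rabs_le_between; lra).
    destruct (Hpt (u - r) t) as [_ HI];
      [apply Rabs_le_between; lra | exact Hy |
       pose proof (Rle_0_sqr (t - v)) as S; unfold Rsqr in S; lra |].
    apply Rabs_le_between in HI.
    pose proof (frac_ge_half (t - v) r r (k * k) Hr Hkk eq_refl Hy) as F.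
    replace (u - r - u) with (- r) in HI by ring.
    replace (- r * - r) with (r * r) in HI by ring.
    rewrite (Rplus_comm (r * r)) in HI.
    unfold Rdiv in *. rewrite Ropp_mult_distr_r_reverse, Ropp_mult_distr_l_reverse in HI.
    unfold B, Rdiv. lra. }
  (* All four sides enter with the same sign, each at least [2 * r * B] in size if [B] is positive;
     a total of zero forces [r * B <= 0], that is [k <= 2 * M]. *)
  unfold boundary_int in H0.
  assert (HB : r * B <= 0) by lra.
  replace (r * B) with (k * (k / 2 - M)) in HB by (unfold B, e; field; lra).
  destruct (Rle_dec k (2 * M)) as [|n]; [assumption|].
  assert (0 < k * (k / 2 - M)) by (apply Rmult_lt_0_compat; lra). lra.
Qed.

(** * Division by zeros and the identity theorem *)

Definition linear_product (Z : list C) (z : C) : C :=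
  fold_right (fun p acc => (z - p) * acc)%C (RtoC 1) Z.

Lemma linear_product_neq_0 (Z : list C) (z : C) :
  ~ In z Z -> linear_product Z z <> 0%C.
Proof.
  induction Z as [|p Z IH]; simpl; intros H.
  - apply C1_nz.
  - apply Cmult_neq_0; [apply Cminus_neq_0; intros E; apply H; auto | apply IH; auto].
Qed.

Lemma linear_product_le (Z : list C) (z : C) (r : R) :
  0 <= r -> (forall p, In p Z -> Cmod (z - p) <= r) ->
  Cmod (linear_product Z z) <= r ^ length Z.
Proof.
  intros Hr. induction Z as [|p Z IH]; simpl; intros H.
  - rewrite Cmod_1. lra.
  - rewrite Cmod_mult. apply Rmult_le_compat; auto using Cmod_ge_0.
Qed.

Lemma linear_product_ge (Z : list C) (z : C) (r : R) :
  0 <= r -> (forall p, In p Z -> r <= Cmod (z - p)) ->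
  r ^ length Z <= Cmod (linear_product Z z).
Proof.
  intros Hr. induction Z as [|p Z IH]; simpl; intros H.
  - rewrite Cmod_1. lra.
  - rewrite Cmod_mult. apply Rmult_le_compat; auto. now apply pow_le.
Qed.

(** The zeros being distinct, the product over those already divided out does not vanish at the next
    one, so the current quotient does. *)
Lemma divide_zeros (f : C -> C) (Z : list C) :
  entire_off nil f -> NoDup Z -> (forall p, In p Z -> f p = 0%C) ->
  exists q, entire_off Z q /\ forall z, f z = (q z * linear_product Z z)%C.
Proof.
  intros Hf HZ. induction HZ as [|p Z Hp HZ IH]; intros H0.
  { exists f. split; [exact Hf | intros z; simpl; ring]. }
  destruct IH as [q [Hq E]]; [intros; apply H0; now right|].
  assert (Hqp : q p = 0%C).
  { destruct (Ceq_dec (q p) 0) as [|n]; [assumption|].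
    destruct (Cmult_neq_0 _ _ n (linear_product_neq_0 Z p Hp)).
    rewrite <- E. apply H0. now left. }
  destruct (slope_entire_off q Z p Hq Hp) as [q2 [Hq2 E2]].
  exists q2. split; [exact Hq2|]. intros z. rewrite E, E2, Hqp. simpl. ring.
Qed.

Lemma accumulating_zeros (f : C -> C) (a : C) :
  (forall d, 0 < d -> exists z, 0 < Cmod (z - a) < d /\ f z = 0%C) ->
  forall n d, 0 < d -> exists Z, length Z = n /\ NoDup Z /\
    forall p, In p Z -> Cmod (p - a) < d /\ f p = 0%C.
Proof.
  intros H. induction n as [|n IH]; intros d Hd.
  { exists nil. repeat split; [constructor | contradiction | contradiction]. }
  destruct (H d Hd) as [z [[H1 H2] H3]].
  (* The other zeros are taken strictly closer to [a] than [z], hence differ from it. *)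
  destruct (IH _ H1) as [Z [HZ1 [HZ2 HZ3]]].
  exists (z :: Z). split; [simpl; congruence|]. split.
  - constructor; [|exact HZ2]. intros Hin. destruct (HZ3 z Hin). lra.
  - intros p [<-|Hin]; [now split|]. destruct (HZ3 p Hin). split; [lra | assumption].
Qed.

(* Dividing [f] by [n] of its zeros near [a] gains a factor [2^n] in the Cauchy
   estimate at [w] on a circle that is large compared to [w - a]. *)
Lemma identity_theorem (f : C -> C) (a : C) :
  entire_off nil f ->
  (forall d, 0 < d -> exists z, 0 < Cmod (z - a) < d /\ f z = 0%C) ->
  forall w, f w = 0%C.
Proof.
  intros Hf H w. apply NNPP. intros Hw.
  pose proof (proj1 (Cmod_gt_0 _) Hw) as Hpos.
  set (r := Cmod (w - a) + 1).
  assert (Hr : 1 <= r) by (pose proof (Cmod_ge_0 (w - a)); unfold r; lra).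
  destruct (bounded_on_disk f w (2 * (3 * r)) (proj1 Hf)) as [M HM].
  assert (Hest : forall n, Cmod (f w) <= 2 * M * (/ 2) ^ n).
  { intros n.
    destruct (accumulating_zeros f a H n 1 Rlt_0_1) as [Z [HZ1 [HZ2 HZ3]]].
    destruct (divide_zeros f Z Hf HZ2 (fun p Hp => proj2 (HZ3 p Hp))) as [q [Hq E]].
    assert (HwZ : ~ In w Z) by (intros Hin; apply Hw, HZ3; exact Hin).
    assert (Hnear : forall p, In p Z -> Cmod (w - p) <= r).
    { intros p Hp. destruct (HZ3 p Hp) as [Hp' _].
      pose proof (Cmod_triangle_3 w a p) as T.
      rewrite (Cmod_minus_sym a p) in T. unfold r. lra. }
    assert (Hpow : 0 < (2 * r) ^ n) by (apply pow_lt; lra).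
    (* The zeros lie within [r] of [w]. On the annulus from [3 * r] to [6 * r] they are at distance
       at least [2 * r], while at [w] the product is at most [r ^ n]: the ratio is [2 ^ n]. *)
    assert (Hq2 : Cmod (q w) <= 2 * (M / (2 * r) ^ n)).
    { apply (cauchy_estimate q Z w (3 * r)); [exact Hq | exact HwZ | lra |].
      intros z [Hz1 Hz2]. apply Rle_div_r; [exact Hpow|].
      apply Rle_trans with (Cmod (f z)); [|now apply HM].
      rewrite E, Cmod_mult. apply Rmult_le_compat_l; [apply Cmod_ge_0|].
      rewrite <- HZ1. apply linear_product_ge; [lra|].
      intros p Hp. specialize (Hnear p Hp).
      pose proof (Cmod_triangle_3 z p w) as T.
      rewrite (Cmod_minus_sym p w) in T. lra. }
    rewrite E, Cmod_mult.
    apply Rle_trans with (2 * (M / (2 * r) ^ n) * r ^ n).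
    - apply Rmult_le_compat; [apply Cmod_ge_0 | apply Cmod_ge_0 | exact Hq2 |].
      rewrite <- HZ1. apply linear_product_le; [lra | exact Hnear].
    - right. rewrite pow_inv, Rpow_mult_distr.
      field. split; apply pow_nonzero; lra. }
  assert (HM0 : 0 < M) by (specialize (Hest 0%nat); simpl in Hest; lra).
  destruct (pow_lt_1_zero (/ 2) ltac:(rewrite Rabs_pos_eq; lra)
    (Cmod (f w) / (2 * M))) as [N HN].
  { apply Rdiv_lt_0_compat; lra. }
  specialize (HN N (Nat.le_refl N)). specialize (Hest N).
  rewrite Rabs_pos_eq in HN by (apply pow_le; lra).
  apply Rlt_div_r in HN; lra.
Qed.

(** * Liouville's argument and entire automorphisms *)

Lemma vanishing_at_infinity (q : C -> C) (L : list C) (w : C) :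
  entire_off L q -> ~ In w L ->
  (forall eps, 0 < eps -> exists r, forall z, r <= Cmod z -> Cmod (q z) <= eps) ->
  q w = 0%C.
Proof.
  intros Hq Hw H. apply Cmod_eq_0.
  assert (Hle : forall eps, 0 < eps -> Cmod (q w) <= eps).
  { intros eps Heps. destruct (H (eps / 2) ltac:(lra)) as [r Hr].
    pose proof (Rle_abs r). pose proof (Rabs_pos r). pose proof (Cmod_ge_0 w).
    apply Rle_trans with (2 * (eps / 2)); [|lra].
    (* With this half-side, every point of the annulus around [w] has modulus at least [r]. *)
    apply (cauchy_estimate q L w (Rabs r + Cmod w + 1)); [exact Hq | exact Hw | lra |].
    intros z [Hz _]. apply Hr.
    pose proof (Cmod_triangle z (- w)) as T. rewrite Cmod_opp in T.
    unfold Cminus in Hz. lra. }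
  pose proof (Cmod_ge_0 (q w)) as H0.
  destruct (Req_dec (Cmod (q w)) 0) as [|n]; [assumption|].
  specialize (Hle (Cmod (q w) / 2) ltac:(lra)). lra.
Qed.

Lemma exists_not_in (L : list C) : exists b, ~ In b L.
Proof.
  assert (H : exists r, forall p, In p L -> Cmod p < r).
  { induction L as [|p L [r IH]]; [exists 0; contradiction|].
    exists (Rmax r (Cmod p + 1)).
    pose proof (Rmax_l r (Cmod p + 1)). pose proof (Rmax_r r (Cmod p + 1)).
    intros p' [<-|Hin]; [lra|]. specialize (IH p' Hin). lra. }
  destruct H as [r Hr]. exists (RtoC r). intros Hin. specialize (Hr _ Hin).
  rewrite Cmod_R in Hr. pose proof (Rle_abs r). lra.
Qed.

(** Subtract the linear interpolation of [k] at two points outside [L] and divide by both linear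
    factors: the second divided difference [k3] decays like [1 / Cmod z], so it vanishes off the
    exceptional points. *)
Lemma linear_growth_affine (k : C -> C) (L : list C) (A B : R) :
  entire_off L k -> (forall z, Cmod (k z) <= A + B * Cmod z) ->
  exists alpha beta, forall z, ~ In z L -> k z = (alpha + beta * z)%C.
Proof.
  intros Hk Hgrow.
  destruct (exists_not_in L) as [b1 Hb1].
  destruct (slope_entire_off k L b1 Hk Hb1) as [k2 [Hk2 E2]].
  destruct (exists_not_in (b1 :: L)) as [b2 Hb2].
  destruct (slope_entire_off k2 (b1 :: L) b2 Hk2 Hb2) as [k3 [Hk3 E3]].
  set (D := k2 b2).
  assert (E : forall z, k z = (k b1 + (z - b1) * (D + (z - b2) * k3 z))%C).
  { intros z. unfold D. rewrite <- E3. apply E2. }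
  (* Where [Cmod z] is at least 1, [F * Cmod z] bounds [k] minus its interpolation. *)
  set (F := Rabs A + Rabs B + Cmod (k b1) + Cmod D * (1 + Cmod b1)).
  pose proof (Cmod_ge_0 (k b1)). pose proof (Cmod_ge_0 b1). pose proof (Cmod_ge_0 b2).
  pose proof (Cmod_ge_0 D). pose proof (Rabs_pos A). pose proof (Rabs_pos B).
  assert (HF : 0 <= F).
  { assert (0 <= Cmod D * (1 + Cmod b1)) by (apply Rmult_le_pos; lra). unfold F; lra. }
  assert (Hzero : forall z, ~ In z (b2 :: b1 :: L) -> k3 z = 0%C).
  { intros z Hz. apply (vanishing_at_infinity k3 _ z Hk3 Hz).
    intros eps Heps.
    (* Beyond this radius both linear factors have modulus at least [Cmod z / 2], and the resulting
       bound [4 * F / Cmod z] on [k3] is at most [eps]. *)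
    exists (1 + 2 * Cmod b1 + 2 * Cmod b2 + 4 * F / eps). clear z Hz. intros z Hz.
    assert (HFe : 0 <= 4 * F / eps) by (apply Rdiv_le_0_compat; lra).
    set (t := Cmod z) in *. assert (Ht : 1 <= t) by lra.
    assert (Hz1 : t / 2 <= Cmod (z - b1)).
    { pose proof (Cmod_triangle (z - b1) b1) as T.
      replace (z - b1 + b1)%C with z in T by ring. fold t in T. lra. }
    assert (Hz2 : t / 2 <= Cmod (z - b2)).
    { pose proof (Cmod_triangle (z - b2) b2) as T.
      replace (z - b2 + b2)%C with z in T by ring. fold t in T. lra. }
    assert (Hnum : Cmod ((z - b1) * (z - b2) * k3 z) <= F * t).
    { replace ((z - b1) * (z - b2) * k3 z)%C
        with (k z - (k b1 + D * (z - b1)))%C by (rewrite (E z); ring).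
      pose proof (Cmod_triangle (k z) (- (k b1 + D * (z - b1)))) as T1.
      rewrite Cmod_opp in T1. fold (Cminus (k z) (k b1 + D * (z - b1))) in T1.
      pose proof (Cmod_triangle (k b1) (D * (z - b1))) as T2. rewrite Cmod_mult in T2.
      pose proof (Cmod_triangle z (- b1)) as T3. rewrite Cmod_opp in T3.
      fold (Cminus z b1) t in T3.
      specialize (Hgrow z). fold t in Hgrow.
      pose proof (Rle_abs A). pose proof (Rle_abs B).
      assert (Cmod D * Cmod (z - b1) <= Cmod D * ((1 + Cmod b1) * t)).
      { apply Rmult_le_compat_l; [assumption|]. nra. }
      assert (B * t <= Rabs B * t) by (apply Rmult_le_compat_r; lra).
      assert (Rabs A * 1 <= Rabs A * t) by (apply Rmult_le_compat_l; lra).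
      assert (Cmod (k b1) * 1 <= Cmod (k b1) * t) by (apply Rmult_le_compat_l; lra).
      unfold F. lra. }
    rewrite !Cmod_mult in Hnum.
    set (m := Cmod (k3 z)) in *. assert (Hm : 0 <= m) by apply Cmod_ge_0.
    assert (Hprod : t / 2 * (t / 2) * m <= F * t).
    { eapply Rle_trans; [|exact Hnum]. apply Rmult_le_compat_r; [exact Hm|].
      apply Rmult_le_compat; lra. }
    assert (Hmt : m * t <= 4 * F) by nra.
    assert (Hte : 4 * F <= eps * t).
    { assert (Hge : 4 * F / eps <= t) by lra. apply Rle_div_l in Hge; lra. }
    nra. }
  exists (k b1 - b1 * D)%C, D. intros z Hz.
  destruct (Ceq_dec z b1) as [->|n1]; [ring|].
  destruct (Ceq_dec z b2) as [->|n2].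
  - rewrite (E b2). ring.
  - rewrite (E z), Hzero; [ring|]. intros [e|[e|Hin]]; auto.
Qed.

Lemma affine_polynomial (f : C -> C) (a b : C) :
  (forall z, f z = (a + b * z)%C) -> polynomial f.
Proof.
  intros H. exists 1%nat, (fun k => match k with O => a | _ => b end).
  intros z. rewrite sum_Sn, sum_O, H.
  change (a + b * z = a * 1 + b * (z * 1))%C. ring.
Qed.

(* With [phi u = a + u * psi u], the function [k = psi o f] satisfies
   [z - a = f z * k z]; it therefore grows at most linearly, since it is bounded
   where [|f| <= 1]. *)
Lemma entire_automorphism_polynomial (f phi : C -> C) :
  entire_off nil f -> entire_off nil phi ->
  (forall z, f (phi z) = z) -> (forall z, phi (f z) = z) -> polynomial f.
Proof.
  intros Hf Hphi Hfp Hpf.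
  destruct (slope_entire_off phi nil 0 Hphi (fun H => H)) as [psi [[Hpc Hpd] E]].
  set (a := phi 0%C) in *.
  set (k := fun z => psi (f z)).
  assert (Hk : forall z, (z - a = f z * k z)%C).
  { intros z. unfold k. pose proof (E (f z)) as Ez. rewrite Hpf in Ez.
    rewrite Ez at 1. ring. }
  (* Only 0 is exceptional for [psi], and [f z = 0] forces [z = phi 0 = a]. *)
  assert (Hkgood : entire_off (a :: nil) k).
  { split.
    - intros z. apply (ccontinuous_comp f psi); [apply Hf | apply Hpc].
    - intros z Hz. apply (cdifferentiable_comp f psi); [now apply Hf|]. apply Hpd.
      intros [H|[]]. apply Hz. left. unfold a. rewrite H. apply Hpf. }
  destruct (bounded_on_disk psi 0 1 Hpc) as [M HM].
  destruct (linear_growth_affine k (a :: nil) (Rabs M + Cmod a) 1 Hkgood)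
    as [alpha [beta Haff]].
  { intros z. pose proof (Cmod_ge_0 a). pose proof (Cmod_ge_0 z).
    pose proof (Rabs_pos M). pose proof (Rle_abs M).
    destruct (Rle_dec (Cmod (f z)) 1) as [Hle|Hle].
    - specialize (HM (f z)). replace (f z - 0)%C with (f z) in HM by ring.
      specialize (HM Hle). unfold k. lra.
    - pose proof (f_equal Cmod (Hk z)) as Hprod. rewrite Cmod_mult in Hprod.
      pose proof (Cmod_triangle z (- a)) as T. rewrite Cmod_opp in T.
      fold (Cminus z a) in T. pose proof (Cmod_ge_0 (k z)). nra. }
  assert (Hfa : f a = 0%C) by apply Hfp.
  assert (Hall : forall z, (z - a = f z * (alpha + beta * z))%C).
  { intros z. destruct (Ceq_dec z a) as [->|n]; [rewrite Hfa; ring|].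
    rewrite (Hk z). f_equal. apply Haff. intros [e|[]]. now apply n. }
  destruct (Ceq_dec beta 0) as [Hb|Hb].
  - assert (Ha : alpha <> 0%C).
    { intros H0. pose proof (Hall (a + 1)%C) as H1. rewrite Hb, H0 in H1.
      apply C1_nz. replace (RtoC 1) with (a + 1 - a)%C by ring. rewrite H1. ring. }
    apply (affine_polynomial f (- a / alpha) (/ alpha)). intros z.
    replace (- a / alpha + / alpha * z)%C with ((z - a) / alpha)%C by (field; exact Ha).
    rewrite Hall, Hb. field. exact Ha.
  (* At the root of [alpha + beta * z] the identity [Hall] gives [z = a], so the root is [a]. Then
     [f] equals [/ beta] everywhere else, which contradicts its injectivity at [a + 1] and
     [a - 1]. *)
  - assert (Hal : alpha = (- beta * a)%C).
    { pose proof (Hall (- alpha / beta)%C) as H1.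
      replace (alpha + beta * (- alpha / beta))%C with (RtoC 0) in H1
        by (field; exact Hb).
      rewrite Cmult_0_r in H1.
      replace (- beta * a)%C with (alpha + beta * (- alpha / beta - a))%C
        by (field; exact Hb).
      rewrite H1. ring. }
    assert (Hval : forall c : C, c <> 0%C -> f (a + c)%C = (/ beta)%C).
    { intros c Hc. pose proof (Hall (a + c)%C) as H1. rewrite Hal in H1.
      replace (f (a + c)%C) with (f (a + c)%C * (- beta * a + beta * (a + c)) / (beta * c))%C
        by (field; split; assumption).
      rewrite <- H1. field. split; assumption. }
    exfalso.
    assert (H12 : (a + 1 = a + - (1))%C).
    { rewrite <- (Hpf (a + 1)%C), <- (Hpf (a + - (1))%C). f_equal.
      rewrite !Hval; [reflexivity | | apply C1_nz].
      intros H. apply C1_nz. replace (RtoC 1) with (- - (1))%C by ring. rewrite H. ring. }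
    apply (f_equal Re) in H12. unfold Re in H12. simpl in H12. lra.
Qed.

(** * Coincidences among iterates of an entire function *)

Lemma entire_off_nil (f : C -> C) : entire f -> entire_off nil f.
Proof.
  intros H.
  assert (D : forall z, cdifferentiable f z).
  { intros z. apply ex_derive_cdifferentiable, H. exact I. }
  split; intros z; [apply cdifferentiable_continuous|]; auto.
Qed.

Lemma entire_off_comp (f g : C -> C) :
  entire_off nil f -> entire_off nil g -> entire_off nil (fun z => g (f z)).
Proof.
  intros [Cf Df] [Cg Dg]. split.
  - intros z. now apply (ccontinuous_comp f g).
  - intros z _. apply (cdifferentiable_comp f g); auto.
Qed.

Lemma entire_off_minus (f g : C -> C) :
  entire_off nil f -> entire_off nil g -> entire_off nil (fun z => f z - g z)%C.
Proof.
  intros [Cf Df] [Cg Dg]. split.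
  - intros z. now apply ccontinuous_minus.
  - intros z _. apply cdifferentiable_minus; auto.
Qed.

Lemma entire_off_const (c : C) : entire_off nil (fun _ => c).
Proof.
  split; intros; [apply ccontinuous_const | apply cdifferentiable_const].
Qed.

Lemma entire_off_iter (f : C -> C) (n : nat) :
  entire_off nil f -> entire_off nil (Nat.iter n f).
Proof.
  intros Hf. induction n as [|n IH].
  - split; intros; [apply ccontinuous_id | apply cdifferentiable_id].
  - exact (entire_off_comp _ _ IH Hf).
Qed.

(* If [d <> 0], its zeros are isolated, so that [h], taking values among them,
   is locally constant. *)
Lemma comp_eq_0 (d h : C -> C) :
  entire_off nil d -> entire_off nil h -> (forall z, d (h z) = 0%C) ->
  (forall z, d z = 0%C) \/ (forall z, h z = h 0%C).
Proof.
  intros Hd Hh H.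
  destruct (classic (forall r, 0 < r ->
    exists z, 0 < Cmod (z - h 0%C) < r /\ d z = 0%C)) as [Hacc|Hiso].
  { left. exact (identity_theorem d _ Hd Hacc). }
  right. apply not_all_ex_not in Hiso. destruct Hiso as [r Hr].
  apply imply_to_and in Hr. destruct Hr as [Hr Hno].
  destruct (proj1 (ccontinuous_eps h 0) (proj1 Hh _) r Hr) as [e [He Hball]].
  assert (Hloc : forall z, Cmod (z - 0) < e -> h z = h 0%C).
  { intros z Hz. destruct (Ceq_dec (h z) (h 0%C)) as [|n]; [assumption|].
    exfalso. apply Hno. exists (h z).
    split; [split; [now apply Cmod_minus_pos | now apply Hball] | apply H]. }
  intros z.
  assert (H0 : (h z - h 0 = 0)%C).
  { apply (identity_theorem (fun z => h z - h 0)%C 0).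
    - apply entire_off_minus; [exact Hh | apply entire_off_const].
    - intros s Hs. pose proof (Rmin_l e s). pose proof (Rmin_r e s).
      pose proof (Rmin_pos e s He Hs).
      exists (RtoC (Rmin e s / 2)).
      assert (Hm : Cmod (RtoC (Rmin e s / 2) - 0) = Rmin e s / 2).
      { replace (RtoC (Rmin e s / 2) - 0)%C with (RtoC (Rmin e s / 2)) by ring.
        rewrite Cmod_R. apply Rabs_pos_eq. lra. }
      split; [rewrite Hm; lra|].
      rewrite Hloc by (rewrite Hm; lra). ring. }
  replace (h z) with (h z - h 0 + h 0)%C by ring. rewrite H0. ring.
Qed.

(** If [f^(n+1)] is the constant [c], then [f - c] vanishes on the range of [f^n], so [f] is
    constant or [f^n] is, and induction applies. The base case would make the identity constant. *)
Lemma iter_const (f : C -> C) (n : nat) :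
  entire_off nil f -> (forall z, Nat.iter n f z = Nat.iter n f 0%C) ->
  forall z, f z = f 0%C.
Proof.
  intros Hf. induction n as [|n IH]; intros H.
  - exfalso. apply C1_nz. apply H.
  - set (c := Nat.iter (S n) f 0%C) in *.
    destruct (comp_eq_0 (fun z => f z - c)%C (Nat.iter n f)) as [H0|H0].
    + apply entire_off_minus; [exact Hf | apply entire_off_const].
    + now apply entire_off_iter.
    + intros z. specialize (H z). simpl in H. rewrite H. ring.
    + intros z. replace (f z) with (f z - c + c)%C by ring.
      replace (f 0%C) with (f 0%C - c + c)%C by ring. now rewrite !H0.
    + now apply IH.
Qed.

Lemma iter_periodic_polynomial (f : C -> C) (m n : nat) :
  entire_off nil f -> (m < n)%nat ->
  (forall z, Nat.iter m f z = Nat.iter n f z) -> polynomial f.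
Proof.
  intros Hf Hmn H.
  (* Here [n = p + S m], so [S p] is [n - m]; if [f^(S p)] is the identity, then [f^p] is the
     two-sided inverse of [f]. *)
  destruct (Nat.le_exists_sub (S m) n Hmn) as [p [Hp _]].
  destruct (comp_eq_0 (fun z => Nat.iter (S p) f z - z)%C (Nat.iter m f)) as [H0|H0].
  - apply entire_off_minus; [|apply (entire_off_iter f 0 Hf)].
    now apply entire_off_iter.
  - now apply entire_off_iter.
  - intros z. rewrite <- Nat.iter_add.
    replace (S p + m)%nat with n by lia. rewrite H. ring.
  - assert (Hid : forall z, Nat.iter (S p) f z = z).
    { intros z. replace (Nat.iter (S p) f z) with (Nat.iter (S p) f z - z + z)%C by ring.
      rewrite H0. ring. }
    apply (entire_automorphism_polynomial f (Nat.iter p f)); auto.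
    + now apply entire_off_iter.
    + intros z. rewrite <- Nat.iter_succ_r. apply Hid.
  - apply (affine_polynomial f (f 0%C) 0). intros z.
    rewrite (iter_const f m Hf H0 z). ring.
Qed.

(** * Iterates of a generator and their constant limit *)

Lemma semigroup_iter (g : nat -> C -> C) (h : C -> C) (n : nat) :
  semigroup g h -> semigroup g (fun z => Nat.iter (S n) h z).
Proof.
  intros Hh. induction n as [|n IH]; [exact Hh|].
  exact (semigroup_comp g h _ Hh IH).
Qed.

Theorem theorem4p3 (g : nat -> C -> C)
    (hg : forall i, transcendental_entire (g i))
    (U : C -> Prop)
    (hU : component (Fatou (semigroup g)) U)
    (hinv : invariant (semigroup g) U)
    (zeta : option C)
    (hzeta : limit_function (semigroup g) U (constant_function zeta)) :
  (exists c : C, zeta = Some c /\ fixed_point (semigroup g) c) \/ zeta = None.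
Proof.
  destruct zeta as [c|]; [left | now right].
  exists c. split; [reflexivity|].
  destruct (hg 0%nat) as [Hent Hnp]. apply entire_off_nil in Hent.
  pose proof (semigroup_gen g 0) as HG. set (f := g 0%nat) in *.
  exists f. split; [exact HG|].
  (* Exponents start at one, since the identity need not belong to the semigroup. *)
  assert (Hdistinct : forall m n, (m < n)%nat ->
    (fun z => Nat.iter (S m) f z) <> (fun z => Nat.iter (S n) f z)).
  { intros m n Hmn E. apply Hnp.
    apply (iter_periodic_polynomial f (S m) (S n) Hent); [lia|].
    intros z. exact (f_equal (fun F => F z) E). }
  destruct (hzeta (fun n z => Nat.iter (S n) f z)) as [phi [_ Hcv]].
  - intros n. now apply semigroup_iter.
  - intros m n E. destruct (Nat.lt_total m n) as [Hlt|[Heq|Hlt]]; [|exact Heq|].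
    + now destruct (Hdistinct m n Hlt).
    + now destruct (Hdistinct n m Hlt).
  - assert (Hpt : forall z, U z -> forall eps, 0 < eps -> exists N, forall n, (N <= n)%nat ->
      Cmod (Nat.iter (S (phi n)) f z - c) < eps).
    { intros z Hz eps Heps. destruct (Hcv z Hz) as [V [HV Hlim]].
      destruct (Hlim (mkposreal eps Heps)) as [N HN].
      exists N. intros n Hn. apply HN; [exact Hn | exact Hz |].
      exact (locally_singleton z V HV). }
    destruct hU as [[z0 Hz0] _].
    assert (Hle : forall eps, 0 < eps -> Cmod (f c - c) <= eps).
    { intros eps Heps.
      destruct (proj1 (ccontinuous_eps f c) (proj1 Hent c) (eps / 2) ltac:(lra))
        as [d [Hd Hball]].
      destruct (Hpt z0 Hz0 d Hd) as [N1 H1].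
      destruct (Hpt (f z0) (hinv f HG z0 Hz0) (eps / 2) ltac:(lra)) as [N2 H2].
      specialize (H1 (N1 + N2)%nat ltac:(lia)). specialize (H2 (N1 + N2)%nat ltac:(lia)).
      apply Hball in H1.
      (* The iterate at [f z0] is [f] of the iterate at [z0], so the point [x] is close both to
         [f c], by continuity, and to [c]. *)
      rewrite <- Nat.iter_succ_r, Nat.iter_succ in H2.
      set (x := f (Nat.iter (S (phi (N1 + N2)%nat)) f z0)) in *.
      pose proof (Cmod_triangle_3 (f c) x c) as T.
      rewrite (Cmod_minus_sym (f c) x) in T. lra. }
    apply NNPP. intros Hne. pose proof (Cmod_minus_pos (f c) c Hne) as Hpos.
    specialize (Hle (Cmod (f c - c) / 2) ltac:(lra)). lra.
Qed.
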